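(* Consider the standing setup below, for a full rate linear dispersive code with full rank generator matrix $\mathbf G$, multiplexing gain $r$, ML diversity gain $d(r)$ and SD complexity exponent $c(r)$, and with sphere radius $\xi^2=z\log\rho$ for a constant $z>d(r)$. For $x\in\mathbb R$ define $$g(x)=\frac{\Pr\big(\{\hat{\mathbf X}_{\mathrm{ML}}\neq \mathbf X\}\cup\{\mathcal N_\kappa=\emptyset\}\cup\{N\ge \rho^x\}\big)}{\Pr(\hat{\mathbf X}_{\mathrm{ML}}\neq\mathbf X)},$$ the ratio of the error probability of a sphere decoder that declares an error when its search set at the last layer is empty or when its node count reaches $\rho^x$, to the ML error probability. Then for every $x>c(r)$, $\lim_{\rho\to\infty} g(x)=1$.
   Context: Standing setup. Let $\rho>0$ (SNR) tend to infinity; $\log$ is base 2. For functions of $\rho$, $f(\rho)\doteq\rho^a$ means $\lim_{\rho\to\infty}\log f(\rho)/\log\rho=a$; $\dot\le,\dot\ge$ are defined with $\limsup\le a$, $\liminf\ge a$. Channel: $\mathbf Y=\mathbf H\mathbf X+\mathbf W$ with $\mathbf H\in\mathbb C^{n_r\times n_t}$ ($n_r\ge n_t$) having i.i.d. circularly symmetric complex Gaussian $\mathcal{CN}(0,1)$ entries, $\mathbf W\in\mathbb C^{n_r\times T}$ with i.i.d. $\mathcal{CN}(0,1)$ entries, independent of $\mathbf H$ and of the codeword. Full rate linear dispersive code: $\kappa=n_tT$, $\mathbf X=\theta\sum_{i=1}^\kappa s_i\mathbf D_i$ with linearly independent $\mathbf D_i\in\mathbb C^{n_t\times T}$, symbols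 $s_i$ drawn i.i.d. uniformly from $\mathcal Q_\eta=\{s\in\mathbb C:\Re s,\Im s\in\mathbb Z\cap[-\eta,\eta]\}$. The generator matrix is $\mathbf G=[\mathrm{vec}(\mathbf D_1)\cdots\mathrm{vec}(\mathbf D_\kappa)]\in\mathbb C^{\kappa\times\kappa}$ (full rank; $\mathrm{vec}$ stacks columns), so $\mathrm{vec}(\mathbf X)=\theta\mathbf G\mathbf s$. For multiplexing gain $r\in[0,n_t]$ the parameters depend on $\rho$ with $\eta\doteq\rho^{rT/(2\kappa)}$ and $\theta^2\doteq\rho^{1-rT/\kappa}$ (so that $\mathrm E\|\mathbf X\|_F^2=\rho T$). The ML decoder is $\hat{\mathbf X}_{\mathrm{ML}}=\arg\min_{\mathbf X'}\|\mathbf Y-\mathbf H\mathbf X'\|_F^2$ over the codebook, and the diversity gain is $d(r)=-\lim_{\rho\to\infty}\log\Pr(\hat{\mathbf X}_{\mathrm{ML}}\ne\mathbf X)/\log\rho$ (assumed to exist). Sphere decoder: let $\mathbf M=\theta(\mathbf I_T\otimes\mathbf H)\mathbf G$, $\mathbf y=\mathrm{vec}(\mathbf Y)$, $\mathbf M=\mathbf Q\mathbf R$ the thin QR decomposition ($\mathbf Q^H\mathbf Q=\mathbf I$, $\mathbf R\in\mathbb C^{\kappa\times\kappa}$ upper triangular), $\mathbf r=\mathbf Q^H\mathbf y$. For $k=1,\dots,\kappa$ let $\mathbf r_k$ be the last $k$ entries of $\mathbf r$ and $\mathbf R_k$ the lower-right $k\times k$ block of $\mathbf R$, and $\mathcal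 N_k=\{\hat{\mathbf s}_k\in\mathcal Q_\eta^k:\|\mathbf r_k-\mathbf R_k\hat{\mathbf s}_k\|^2\le\xi^2\}$, $N_k=|\mathcal N_k|$, and the complexity (number of visited nodes) $N=\sum_{k=1}^\kappa N_k$. The radius is $\xi^2=z\log\rho$ with a constant $z>d(r)$. Define $\Psi(x)=-\lim_{\rho\to\infty}\log\Pr(N\ge\rho^x)/\log\rho$ (assumed to exist) and the SD complexity exponent $c(r)=\inf\{x:\Psi(x)>d(r)\}$. *)

(* Defs.v *)
From HB Require Import structures.
From mathcomp Require Import all_boot all_order all_algebra.
From mathcomp Require Import complex mxtens.
From mathcomp Require Import all_classical all_reals all_analysis.
From mathcomp Require Import zify.

Set Implicit Arguments.
Unset Strict Implicit.
Unset Printing Implicit Defensive.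

Import Order.TTheory GRing.Theory Num.Theory.
Import numFieldNormedType.Exports.
Local Open Scope classical_set_scope.
Local Open Scope ring_scope.

Section Defs.
Variable R : realType.
Local Notation C := R[i].

Definition csq (c : C) : R := complex.Re c ^+ 2 + complex.Im c ^+ 2.

Definition vnorm2 {m : nat} (v : 'cV[C]_m) : R := \sum_(i < m) csq (v i 0).

Definition fnorm2 {m n : nat} (A : 'M[C]_(m, n)) : R :=
  \sum_(i < m) \sum_(j < n) csq (A i j).

Definition herm {m n : nat} (A : 'M[C]_(m, n)) : 'M[C]_(n, m) :=
  (map_mx (@conjc R) A)^T.

Definition cip {m : nat} (u v : 'cV[C]_m) : C :=
  \sum_(i < m) conjc (u i 0) * v i 0.

(* vec(A): stacks the columns of A : 'M_(m,n); entry index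
   mxtens_index (j, i) = j * m + i holds A i j (column-major), matching the
   index convention of the Kronecker product [*t]. *)
Definition vec {m n : nat} (A : 'M[C]_(m, n)) : 'cV[C]_(n * m) :=
  \col_k A (mxtens_unindex k).2 (mxtens_unindex k).1.

(** ---------- thin QR decomposition (Gram--Schmidt) ----------
   For M : 'M_(m,n) with n <= m this produces Q : 'M_(m,n) with Q^H Q = I and
   R : 'M_n upper triangular with nonnegative real diagonal and M = Q R.
   When the j-th Gram--Schmidt residual vanishes (rank-deficient M, a
   probability-zero event in the theorem) the j-th column of Q is taken as the
   normalised residual of the first standard basis vector not in the span of the
   previous columns.  In the full column rank case this is THE (unique) thin QR
   decomposition with positive diagonal. *)

Definition gs_res {m : nat} (qs : seq 'cV[C]_m) (v : 'cV[C]_m) : 'cV[C]_m :=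
  v - \sum_(q <- qs) cip q v *: q.

Definition gs_next {m : nat} (qs : seq 'cV[C]_m) (c : 'cV[C]_m) : 'cV[C]_m :=
  let cands := gs_res qs c :: [seq gs_res qs (delta_mx k 0) | k <- enum 'I_m] in
  let w := nth 0 cands (find (fun v => v != 0) cands) in
  ((Num.sqrt (vnorm2 w))^-1)%:C%C *: w.

Definition gs_cols {m : nat} (cols : seq 'cV[C]_m) : seq 'cV[C]_m :=
  foldl (fun qs c => rcons qs (gs_next qs c)) [::] cols.

Definition qrQ {m n : nat} (M : 'M[C]_(m, n)) : 'M[C]_(m, n) :=
  let qs := gs_cols [seq col j M | j <- enum 'I_n] in
  \matrix_(i, j) (nth 0 qs j) i 0.

Definition qrR {m n : nat} (M : 'M[C]_(m, n)) : 'M[C]_n :=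
  \matrix_(i, j) (if (i <= j)%N then cip (col i (qrQ M)) (col j M) else 0).

(** ---------- the QAM alphabet Q_eta ----------
   Q_eta = { a + b i : a, b integers in [-eta, eta] }, indexed by
   'I_(2 eta + 1) * 'I_(2 eta + 1). *)
Definition qidx (eta : nat) := ('I_(2 * eta + 1) * 'I_(2 * eta + 1))%type.

Definition qval (eta : nat) (a : qidx eta) : C :=
  Complex ((a.1 : nat)%:R - eta%:R) ((a.2 : nat)%:R - eta%:R).

Definition symvec (k eta : nat) := {ffun 'I_k -> qidx eta}.

Definition kappa (nt T : nat) : nat := (T * nt)%N.

Definition genmx_of {nt T : nat} (D : 'I_(kappa nt T) -> 'M[C]_(nt, T))
  : 'M[C]_(kappa nt T) :=
  \matrix_(k, i) vec (D i) k 0.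

Definition codeword {nt T : nat} (D : 'I_(kappa nt T) -> 'M[C]_(nt, T))
  (theta : R) (eta : nat) (s : symvec (kappa nt T) eta) : 'M[C]_(nt, T) :=
  theta%:C%C *: \sum_(i < kappa nt T) qval (s i) *: D i.

(** ---------- the random channel ----------
   One family of real Gaussians: the real (true) and imaginary (false) parts of
   the entries of H (left) and of W (right). *)
Definition gidx (nr nt T : nat) :=
  ((('I_nr * 'I_nt) + ('I_nr * 'I_T)) * bool)%type.

Definition chanH {Omega : Type} {nr nt T : nat} (g : gidx nr nt T -> Omega -> R)
  (w : Omega) : 'M[C]_(nr, nt) :=
  \matrix_(i, j) Complex (g (inl (i, j), true) w) (g (inl (i, j), false) w).

Definition noiseW {Omega : Type} {nr nt T : nat} (g : gidx nr nt T -> Omega -> R)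
  (w : Omega) : 'M[C]_(nr, T) :=
  \matrix_(i, j) Complex (g (inr (i, j), true) w) (g (inr (i, j), false) w).

(* the family g is i.i.d. N(0, sigma^2) (sigma = standard deviation) *)
Definition iid_normal {d : measure_display} {Omega : measurableType d}
  (P : probability Omega R) {I : finType} (g : I -> Omega -> R) (sigma : R)
  : Prop :=
  [/\ (forall i, measurable_fun setT (g i)),
      (forall i (A : set R), measurable A ->
          P (g i @^-1` A) = normal_prob 0 sigma A) &
      (forall B : I -> set R, (forall i, measurable (B i)) ->
          P (\bigcap_(i in setT) (g i @^-1` B i)) =
          (\prod_(i : I) P (g i @^-1` B i))%E)].

Definition received {Omega : Type} {nr nt T : nat} (g : gidx nr nt T -> Omega -> R)
  (D : 'I_(kappa nt T) -> 'M[C]_(nt, T)) (theta : R) (eta : nat)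
  (w : Omega) (s : symvec (kappa nt T) eta) : 'M[C]_(nr, T) :=
  chanH g w *m codeword D theta s + noiseW g w.

(* the ML decoder errs: some other codeword is at least as close to Y
   (ties counted as errors; ties have probability zero) *)
Definition ml_error {Omega : Type} {nr nt T : nat} (g : gidx nr nt T -> Omega -> R)
  (D : 'I_(kappa nt T) -> 'M[C]_(nt, T)) (theta : R) (eta : nat)
  (w : Omega) (s : symvec (kappa nt T) eta) : Prop :=
  exists s' : symvec (kappa nt T) eta,
    codeword D theta s' != codeword D theta s /\
    fnorm2 (received g D theta w s - chanH g w *m codeword D theta s')
      <= fnorm2 (received g D theta w s - chanH g w *m codeword D theta s).

Definition sdM {Omega : Type} {nr nt T : nat} (g : gidx nr nt T -> Omega -> R)
  (D : 'I_(kappa nt T) -> 'M[C]_(nt, T)) (theta : R) (w : Omega)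
  : 'M[C]_(T * nr, kappa nt T) :=
  theta%:C%C *: (((1%:M : 'M[C]_T) *t chanH g w) *m genmx_of D).

Definition sdr {Omega : Type} {nr nt T : nat} (g : gidx nr nt T -> Omega -> R)
  (D : 'I_(kappa nt T) -> 'M[C]_(nt, T)) (theta : R) (eta : nat)
  (w : Omega) (s : symvec (kappa nt T) eta) : 'cV[C]_(kappa nt T) :=
  herm (qrQ (sdM g D theta w)) *m vec (received g D theta w s).

End Defs.

Lemma tail_lt (n : nat) (k : 'I_n.+1) (j : 'I_k) : (n - k + j < n)%N.
Proof.
case: k j => k /= hk [j /= hj]; lia.
Qed.

Definition tailidx (n : nat) (k : 'I_n.+1) (j : 'I_k) : 'I_n := Ordinal (tail_lt j).

Section SD.
Variable R : realType.
Local Notation C := R[i].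

Definition sdNk {Omega : Type} {nr nt T : nat} (g : gidx nr nt T -> Omega -> R)
  (D : 'I_(kappa nt T) -> 'M[C]_(nt, T)) (theta : R) (eta : nat) (xi2 : R)
  (w : Omega) (s : symvec (kappa nt T) eta) (k : 'I_(kappa nt T).+1) : nat :=
  let r := sdr g D theta w s in
  let Rm := qrR (sdM g D theta w) in
  #|[set t : symvec k eta |
      \sum_(i < k) csq (r (tailidx i) 0
                        - \sum_(j < k) Rm (tailidx i) (tailidx j) * qval R (t j))
      <= xi2]|.

Definition sdN {Omega : Type} {nr nt T : nat} (g : gidx nr nt T -> Omega -> R)
  (D : 'I_(kappa nt T) -> 'M[C]_(nt, T)) (theta : R) (eta : nat) (xi2 : R)
  (w : Omega) (s : symvec (kappa nt T) eta) : nat :=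
  (\sum_(k < (kappa nt T).+1 | (0 < k)%N) sdNk g D theta xi2 w s k)%N.

(* probability of an event depending on the channel and on the transmitted
   symbol vector s, where s is uniform on Q_eta^kappa, independent of (H, W) *)
Definition Prob {d : measure_display} {Omega : measurableType d}
  (P : probability Omega R) (k eta : nat) (E : Omega -> symvec k eta -> Prop) : R :=
  (#|{: symvec k eta}|%:R)^-1 *
  \sum_(s : symvec k eta) fine (P [set w | E w s]).

(* -log p / log rho, with log 0 = -oo  (the base of log cancels) *)
Definition expo (p rho : R) : \bar R :=
  if p == 0 then +oo%E else (- ln p / ln rho)%:E.

Definition doteq (f : R -> R) (a : R) : Prop :=
  (\forall rho \near +oo, 0 < f rho) /\
  (ln (f rho) / ln rho @[rho --> +oo] --> a).

(* c = inf { x : Psi x > d } (in the extended reals; inf of empty = +oo) *)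
Definition sd_exponent (Psi : R -> \bar R) (d : R) : \bar R :=
  ereal_inf [set x%:E | x in [set x : R | (d%:E < Psi x)%E]].

End SD.

(* Main.v *)
(* By the union bound, [g x - 1] is at most the sum of Pr(N_kappa empty) and
   Pr(N >= rho^x), divided by Pr(ML error), which decays like rho^(-d(r)).
   Since [x > c(r)], the node-count term decays at a rate Psi(y) > d(r) for some
   [y < x].  For the emptiness term, Q^H M = R holds even in the degenerate cases
   of Gram-Schmidt, so the transmitted vector has residual Q^H vec(W), and by
   Bessel's inequality the search set can be empty only if ||W||^2 exceeds
   z log_2 rho.  Gaussian tails give Pr(||W||^2 > t) = O(exp(- lam t)) for every
   lam < 1; as ln 2 < 1, taking lam = ln 2 yields O(rho^(-z)), and z > d(r).
   All events involved have to be shown measurable, the value of a measure on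
   other sets being unspecified. *)
Require Import Defs.
From HB Require Import structures.
From mathcomp Require Import all_boot all_order all_algebra.
From mathcomp Require Import complex mxtens.
From mathcomp Require Import all_classical all_reals all_analysis.
From mathcomp Require Import measurable_realfun measurable_fun_approximation.
From mathcomp Require Import ring lra.

Set Implicit Arguments.
Unset Strict Implicit.
Unset Printing Implicit Defensive.

Import Order.TTheory GRing.Theory Num.Theory.
Import numFieldNormedType.Exports.
Local Open Scope classical_set_scope.
Local Open Scope ring_scope.

(** * Gram-Schmidt and the thin QR decomposition *)

Section HermitianForm.
Variables (R : realType) (m : nat).
Local Notation C := R[i].
Implicit Types (u v q : 'cV[C]_m) (a : C).

Lemma csq_ge0 a : 0 <= csq a.
Proof. by rewrite /csq addr_ge0 ?sqr_ge0. Qed.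

Lemma csq_eq0 a : (csq a == 0) = (a == 0).
Proof.
rewrite /csq paddr_eq0 ?sqr_ge0 // !sqrf_eq0.
by case: a => x y; rewrite eq_complex.
Qed.

Lemma csq0 : csq (0 : C) = 0.
Proof. by apply/eqP; rewrite csq_eq0. Qed.

Lemma conjcM_csq a : conjc a * a = (csq a)%:C%C.
Proof. by case: a => x y; rewrite /csq; simpc; congr Complex; ring. Qed.

Lemma vnorm2_ge0 v : 0 <= vnorm2 v.
Proof. by apply: sumr_ge0 => i _; exact: csq_ge0. Qed.

Lemma vnorm2_eq0 v : (vnorm2 v == 0) = (v == 0).
Proof.
rewrite /vnorm2 psumr_eq0 => [|i _]; last exact: csq_ge0.
apply/allP/eqP => [h|-> i _]; last by rewrite mxE csq_eq0 eqxx.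
apply/colP => i; rewrite mxE; apply/eqP; rewrite -csq_eq0.
exact: h (mem_index_enum i).
Qed.

Lemma cipDr q u v : cip q (u + v) = cip q u + cip q v.
Proof. by rewrite /cip -big_split; apply: eq_bigr => i _; rewrite mxE mulrDr. Qed.

Lemma cipZr q a v : cip q (a *: v) = a * cip q v.
Proof. by rewrite /cip mulr_sumr; apply: eq_bigr => i _; rewrite mxE mulrCA. Qed.

Lemma cipNr q v : cip q (- v) = - cip q v.
Proof. by rewrite -scaleN1r cipZr mulN1r. Qed.

Lemma cip0r q : cip q 0 = 0.
Proof. by rewrite -(scale0r 0) cipZr mul0r. Qed.

Lemma cip_sumr q I (s : seq I) (F : I -> 'cV[C]_m) :
  cip q (\sum_(i <- s) F i) = \sum_(i <- s) cip q (F i).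
Proof. by apply: (big_morph (cip q)) => [u v|]; rewrite ?cipDr ?cip0r. Qed.

Lemma cipC u v : cip u v = conjc (cip v u).
Proof.
rewrite /cip rmorph_sum; apply: eq_bigr => i _.
by rewrite rmorphM /= conjcK mulrC.
Qed.

Lemma cipZl a u v : cip (a *: u) v = conjc a * cip u v.
Proof. by rewrite cipC cipZr rmorphM /= -cipC. Qed.

Lemma cip0l v : cip 0 v = 0.
Proof. by rewrite cipC cip0r conjc0. Qed.

Lemma cipDl u v q : cip (u + v) q = cip u q + cip v q.
Proof. by rewrite cipC cipDr rmorphD /= -!cipC. Qed.

Lemma cip_self v : cip v v = (vnorm2 v)%:C%C.
Proof.
rewrite /cip /vnorm2 rmorph_sum; apply: eq_bigr => i _; exact: conjcM_csq.
Qed.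

(** Pythagoras for one projection, the induction step of Bessel's inequality. The case [q = 0]
    accommodates the zero vectors that degenerate Gram-Schmidt produces. *)
Lemma vnorm2_sub_proj q u : vnorm2 q = 1 \/ q = 0 ->
  vnorm2 (u - cip q u *: q) = vnorm2 u - csq (cip q u).
Proof.
case=> [q1|->]; last by rewrite cip0l csq0 !subr0 scale0r subr0.
(* Over the complex numbers [vnorm2 v] is [cip v v], which expands by sesquilinearity. *)
suff : (vnorm2 (u - cip q u *: q))%:C%C = (vnorm2 u - csq (cip q u))%:C%C by case.
have qq : cip q q = 1 by rewrite cip_self q1.
rewrite -cip_self cipDr cipNr cipZr !cipDl -!scaleNr !cipZl qq cip_self.
rewrite (cipC u q) rmorphB /= -conjcM_csq rmorphN /=.
by rewrite mulr1 subrr scaler0 addr0 mulNr.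
Qed.

End HermitianForm.

Section GramSchmidt.
Variables (R : realType) (m : nat).
Local Notation C := R[i].
Implicit Types (u v q c : 'cV[C]_m) (qs cs : seq 'cV[C]_m).

(* Zero vectors are allowed: they occur when Gram-Schmidt runs out of
   candidates (more columns than dimensions). *)
Definition orthonormal0 qs :=
  (forall q, q \in qs -> vnorm2 q = 1 \/ q = 0) /\
  (forall i j, (i < size qs)%N -> (j < size qs)%N -> i != j ->
     cip (nth 0 qs i) (nth 0 qs j) = 0).

Lemma gs_res_rcons qs q v : gs_res (rcons qs q) v = gs_res qs v - cip q v *: q.
Proof. by rewrite /gs_res -cats1 big_cat big_seq1 opprD addrA. Qed.

Lemma orthonormal0_rconsP qs q : orthonormal0 (rcons qs q) <->
  [/\ orthonormal0 qs, vnorm2 q = 1 \/ q = 0 &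
      forall q', q' \in qs -> cip q' q = 0].
Proof.
split=> [[qn qo]|[[qn qo] q1 qq]].
  split.
  - split=> [q' q'in|i j ilt jlt ij].
      by apply: qn; rewrite mem_rcons inE q'in orbT.
    have := qo i j; rewrite size_rcons !nth_rcons ilt jlt.
    by apply=> //; rewrite ltnS ltnW.
  - by apply: qn; rewrite mem_rcons mem_head.
  - move=> q' /(nthP 0) [i ilt <-].
    have := qo i (size qs); rewrite size_rcons !nth_rcons ilt ltnn eqxx.
    by apply; rewrite ?ltnS ?leqnn 1?ltnW // ltn_eqF.
split=> [q'|i j]; first by rewrite mem_rcons inE => /predU1P[->//|]; exact: qn.
rewrite size_rcons !ltnS !nth_rcons.
case: (ltngtP i (size qs)) => // [il _|iE _].
  by case: (ltngtP j (size qs)) => // [jl _ ij|jE _ _]; [exact: qo|exact: qq (mem_nth _ _)].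
case: (ltngtP j (size qs)) => // [jl _ _|jE _]; last by rewrite iE jE eqxx.
by rewrite cipC qq ?conjc0 ?mem_nth.
Qed.

(** The part removed from [v] lies in the span of [qs], orthogonal to [q]. So Gram-Schmidt
    coefficients may be computed from the current residual instead of the original vector. *)
Lemma cip_gs_res_rcons qs q v : orthonormal0 (rcons qs q) ->
  cip q (gs_res qs v) = cip q v.
Proof.
move=> /orthonormal0_rconsP[oqs _ qq].
rewrite /gs_res cipDr cipNr cip_sumr big1_seq ?subr0 // => q' /andP[_ q'in].
by rewrite cipZr (cipC q q') qq // conjc0 mulr0.
Qed.

Lemma cip_gs_res qs q v : orthonormal0 qs -> q \in qs -> cip q (gs_res qs v) = 0.
Proof.
elim/last_ind: qs q => [//|qs q0 IH] q on.
have q0r := cip_gs_res_rcons v on.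
have /orthonormal0_rconsP[oqs q01 qq] := on.
rewrite gs_res_rcons cipDr cipNr cipZr mem_rcons inE => /predU1P[->|qin].
  rewrite q0r cip_self; case: q01 => [->|->]; first by rewrite mulr1 subrr.
  by rewrite !cip0l mul0r subrr.
by rewrite IH // qq // mulr0 subrr.
Qed.

(** Each projection lowers the squared norm by exactly [csq (cip q v)], so the gap between the two
    sides is the squared norm of the final residual. *)
Lemma bessel qs v : orthonormal0 qs ->
  \sum_(q <- qs) csq (cip q v) <= vnorm2 v.
Proof.
move=> oqs.
suff -> : \sum_(q <- qs) csq (cip q v) = vnorm2 v - vnorm2 (gs_res qs v).
  by rewrite lerBlDr lerDl vnorm2_ge0.
elim/last_ind: qs oqs => [|qs q IH] oqs.
  by rewrite big_nil /gs_res big_nil subr0 subrr.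
have /orthonormal0_rconsP[oqs' q1 _] := oqs.
rewrite gs_res_rcons -(cip_gs_res_rcons v oqs) vnorm2_sub_proj //.
rewrite -cats1 big_cat big_seq1 /= IH // cip_gs_res_rcons //; ring.
Qed.

(** Every candidate is a residual modulo [qs], hence orthogonal to [qs]. A nonzero residual of [c]
    is the first candidate and is therefore the one selected, so its normalisation absorbs it; a
    zero residual stays zero. *)
Lemma gs_next_spec qs c : orthonormal0 qs ->
  orthonormal0 (rcons qs (gs_next qs c)) /\
  gs_res (rcons qs (gs_next qs c)) c = 0.
Proof.
move=> oqs; rewrite /gs_next.
set cands := _ :: _; set w := nth 0 cands _.
have normw : w != 0 -> 0 < Num.sqrt (vnorm2 w).
  by move=> w0; rewrite sqrtr_gt0 lt_def vnorm2_ge0 vnorm2_eq0 w0.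
have wE : exists v, w = gs_res qs v.
  have [flt|fge] := ltnP (find (fun v => v != 0) cands) (size cands).
    have : w \in cands by exact: mem_nth.
    rewrite inE => /predU1P[->|/mapP[k _ ->]]; first by exists c.
    by exists (delta_mx k 0).
  (* If all candidates vanish, [nth] returns its default [0], which is the residual of the zero
     vector. *)
  exists 0; rewrite /w nth_default // /gs_res big1 ?subr0 // => q _.
  by rewrite cip0r scale0r.
have ow q : q \in qs -> cip q w = 0.
  by move=> qin; case: wE => v ->; exact: cip_gs_res.
set sq := Num.sqrt (vnorm2 w) in normw *.
have sqE : vnorm2 w = sq ^+ 2 by rewrite sqr_sqrtr ?vnorm2_ge0.
set q := _ *: w.
have onq : orthonormal0 (rcons qs q).
  apply/orthonormal0_rconsP; split=> // [|q' q'in]; last first.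
    by rewrite cipZr ow // mulr0.
  have [w0|/normw w0] := eqVneq w 0; first by right; rewrite /q w0 scaler0.
  left; suff : (vnorm2 q)%:C%C = 1%:C%C :> C by case.
  rewrite -cip_self /q cipZr cipZl cip_self conjc_real sqE -!rmorphM /=.
  congr (_%:C)%C.
  by field; rewrite gt_eqF.
split=> //; rewrite gs_res_rcons -(cip_gs_res_rcons _ onq).
have [r0|r0] := eqVneq (gs_res qs c) 0; first by rewrite r0 cip0r scale0r subr0.
have wr : w = gs_res qs c by rewrite /w /cands /= r0.
have w0 : 0 < sq by apply: normw; rewrite wr.
rewrite -wr /q cipZl conjc_real cip_self scalerA sqE -!rmorphM /=.
rewrite (_ : _ * _ = 1); last by field; rewrite gt_eqF.
by rewrite scale1r subrr.
Qed.

Lemma gs_cols_rcons cs c : gs_cols (rcons cs c) = rcons (gs_cols cs) (gs_next (gs_cols cs) c).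
Proof. by rewrite /gs_cols foldl_rcons. Qed.

Lemma size_gs_cols cs : size (gs_cols cs) = size cs.
Proof. by elim/last_ind: cs => // cs c IH; rewrite gs_cols_rcons !size_rcons IH. Qed.

Lemma orthonormal0_gs_cols cs : orthonormal0 (gs_cols cs).
Proof.
elim/last_ind: cs => [|cs c IH]; first by split.
by rewrite gs_cols_rcons; case: (gs_next_spec c IH).
Qed.

Lemma gs_res_gs_cols cs c : c \in cs -> gs_res (gs_cols cs) c = 0.
Proof.
elim/last_ind: cs => [//|cs c' IH].
have [on r0] := gs_next_spec c' (orthonormal0_gs_cols cs).
rewrite gs_cols_rcons mem_rcons inE => /predU1P[->//|/IH r].
by rewrite gs_res_rcons -(cip_gs_res_rcons _ on) r cip0r scale0r subr0.
Qed.

(** An earlier input column has zero residual modulo the outputs available before position [i],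
    hence lies in their span, to which the output at [i] is orthogonal. *)
Lemma cip_gs_cols cs i j : (j < i < size cs)%N ->
  cip (nth 0 (gs_cols cs) i) (nth 0 cs j) = 0.
Proof.
elim/last_ind: cs => [|cs c IH]; first by rewrite ltn0 andbF.
rewrite gs_cols_rcons size_rcons ltnS => /andP[ji].
have [on _] := gs_next_spec c (orthonormal0_gs_cols cs).
rewrite leq_eqVlt => /predU1P[iE|ilt]; last first.
  by rewrite !nth_rcons size_gs_cols ilt (ltn_trans ji ilt) IH ?ji.
rewrite !nth_rcons size_gs_cols iE ltnn eqxx -iE ji.
by rewrite -(cip_gs_res_rcons _ on) gs_res_gs_cols ?cip0r // mem_nth // -iE.
Qed.

End GramSchmidt.

Section QR.
Variables (R : realType) (m n : nat).
Local Notation C := R[i].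
Implicit Types (M : 'M[C]_(m, n)) (v : 'cV[C]_m).

Let cols M := [seq col j M | j <- enum 'I_n].

Let size_cols M : size (cols M) = n.
Proof. by rewrite size_map size_enum_ord. Qed.

Lemma col_qrQ M (i : 'I_n) : col i (qrQ M) = nth 0 (gs_cols (cols M)) i.
Proof. by apply/colP => k; rewrite !mxE. Qed.

Lemma herm_mulE (A : 'M[C]_(m, n)) p (B : 'M[C]_(m, p)) i j :
  (herm A *m B) i j = cip (col i A) (col j B).
Proof. by rewrite /herm /cip !mxE; apply: eq_bigr => k _; rewrite !mxE. Qed.

(** On and above the diagonal this is the definition of [qrR]; below it, [cip_gs_cols] supplies the
    zeros. *)
Lemma herm_qrQ_mul M : herm (qrQ M) *m M = qrR M.
Proof.
apply/matrixP => i j; rewrite herm_mulE mxE.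
case: leqP => // ji; rewrite col_qrQ.
have -> : col j M = nth 0 (cols M) j.
  by rewrite (nth_map j) ?size_enum_ord // nth_ord_enum.
by rewrite cip_gs_cols // ji size_cols ltn_ord.
Qed.

Lemma vnorm2_herm_qrQ M v : vnorm2 (herm (qrQ M) *m v) <= vnorm2 v.
Proof.
apply: le_trans (bessel v (orthonormal0_gs_cols (cols M))).
rewrite (big_nth 0) size_gs_cols size_cols big_mkord le_eqVlt /vnorm2.
apply/orP; left; apply/eqP; apply: eq_bigr => i _.
rewrite herm_mulE col_qrQ; congr (csq (cip _ _)).
by apply/colP => k; rewrite !mxE.
Qed.

End QR.

(** * The sphere decoder's residual as projected noise *)

Section SphereDecoder.
Variable R : realType.
Local Notation C := R[i].

Lemma vecD m n (A B : 'M[C]_(m, n)) : vec (A + B) = vec A + vec B.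
Proof. by apply/colP => k; rewrite !mxE. Qed.

(** Turns the matrix channel into the linear system that is QR-decomposed. In the double sum over
    the unflattened index, the identity factor keeps only the block [a = j]. *)
Lemma vec_mulmx m n p (A : 'M[C]_(m, n)) (B : 'M[C]_(n, p)) :
  vec (A *m B) = (1%:M *t A) *m vec B.
Proof.
apply/colP => k; case: (mxtens_indexP k) => j i.
rewrite [LHS]mxE mxtens_indexK /= [LHS]mxE mxE.
rewrite (reindex _ (onW_bij _ (Bijective (@mxtens_indexK _ _) (@mxtens_unindexK _ _)))) /=.
transitivity (\sum_a \sum_b (1%:M *t A) (mxtens_index (j, i)) (mxtens_index (a, b)) *
    vec B (mxtens_index (a, b)) 0); last first.
  by rewrite pair_bigA; apply: eq_bigr => -[a b].
rewrite (bigD1 j) //= [X in _ + X]big1 ?addr0 => [|a aj].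
  by apply: eq_bigr => b _; rewrite tensmxE !mxE eqxx mul1r mxtens_indexK.
by apply: big1 => b _; rewrite tensmxE mxE eq_sym (negPf aj) !mul0r.
Qed.

Lemma vnorm2_vec m n (A : 'M[C]_(m, n)) : vnorm2 (vec A) = fnorm2 A.
Proof.
rewrite /vnorm2 /fnorm2 (reindex_onto (@mxtens_index _ _) (@mxtens_unindex _ _)) /=;
  last by move=> *; rewrite mxtens_unindexK.
rewrite exchange_big pair_bigA; apply: eq_big => [l|[a b] _].
  by rewrite mxtens_indexK eqxx.
by rewrite mxE mxtens_indexK.
Qed.

Lemma vec_codeword nt T (D : 'I_(kappa nt T) -> 'M[C]_(nt, T)) theta eta
    (s : symvec (kappa nt T) eta) :
  vec (codeword D theta s) = theta%:C%C *: (genmx_of D *m \col_i qval R (s i)).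
Proof.
apply/colP => k; rewrite !mxE; congr (_ * _); rewrite summxE.
by apply: eq_bigr => i _; rewrite !mxE mulrC.
Qed.

Section Channel.
Variables (Omega : Type) (nr nt T : nat) (g : gidx nr nt T -> Omega -> R).
Variables (D : 'I_(kappa nt T) -> 'M[C]_(nt, T)) (theta : R) (eta : nat).
Variables (w : Omega) (s : symvec (kappa nt T) eta).

(** Vectorising the channel gives [vec Y = M s + vec W], and [herm Q *m M] is the triangular factor,
    so the signal part cancels. *)
Lemma sdr_noise : sdr g D theta w s - qrR (sdM g D theta w) *m \col_i qval R (s i)
  = herm (qrQ (sdM g D theta w)) *m vec (noiseW g w).
Proof.
rewrite /sdr /received vecD vec_mulmx vec_codeword mulmxDr -herm_qrQ_mul.
rewrite [X in X + _ - _](_ : _ =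
  herm (qrQ (sdM g D theta w)) *m sdM g D theta w *m \col_i qval R (s i)).
  by rewrite addrAC subrr add0r.
by rewrite -scalemxAr -!mulmxA /sdM -!scalemxAl -!scalemxAr -?scalemxAl !mulmxA.
Qed.

Definition sd_dist (k : 'I_(kappa nt T).+1) (t : symvec k eta) : R :=
  \sum_(i < k) csq (sdr g D theta w s (tailidx i) 0
    - \sum_(j < k) qrR (sdM g D theta w) (tailidx i) (tailidx j) * qval R (t j)).

(** As a sum of indicators, the count serves both the emptiness argument and the measurability
    proof. *)
Lemma sdNkE xi2 (k : 'I_(kappa nt T).+1) :
  sdNk g D theta xi2 w s k = (\sum_(t : symvec k eta) (sd_dist t <= xi2)%R)%N.
Proof.
rewrite /sdNk /= -sum1_card big_mkcond; apply: eq_bigr => t _ /=.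
rewrite [X in if X then _ else _](_ : _ = (sd_dist t <= xi2)); first by case: ifP.
exact: asboolb.
Qed.

Lemma sd_empty_noise xi2 : sdNk g D theta xi2 w s ord_max = 0%N ->
  xi2 < fnorm2 (noiseW g w).
Proof.
rewrite sdNkE => /eqP; rewrite sum_nat_eq0.
(* The transmitted vector itself is tested at the last layer. *)
move=> /forallP /(_ (s : symvec (ord_max : 'I_(kappa nt T).+1) eta)) /=.
rewrite eqb0 -ltNge => /lt_le_trans; apply.
rewrite -vnorm2_vec; apply: le_trans (vnorm2_herm_qrQ (sdM g D theta w) _).
rewrite -sdr_noise /vnorm2 le_eqVlt; apply/orP; left; apply/eqP.
(* At the last layer the index offset [n - k] is zero. *)
have tE (j : 'I_(kappa nt T)) : @tailidx _ ord_max j = j.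
  by apply: val_inj; rewrite /= subnn.
apply: eq_bigr => i _; rewrite tE; congr csq.
rewrite [RHS]mxE; congr (_ + _); rewrite [RHS]mxE; congr (- _); rewrite [RHS]mxE.
by apply: eq_bigr => j _; rewrite !tE; congr (_ * _); rewrite mxE.
Qed.

End Channel.
End SphereDecoder.

(** * Measurability of the decoding events *)

Section ComplexMeasurability.
Variables (R : realType) (d : measure_display) (Omega : measurableType d).
Local Notation C := R[i].

Definition cmeas (f : Omega -> C) :=
  measurable_fun setT (fun w => complex.Re (f w)) /\
  measurable_fun setT (fun w => complex.Im (f w)).

Lemma cmeas_cst (c : C) : cmeas (fun=> c).
Proof. by split; exact: measurable_cst. Qed.

Lemma cmeas_Complex (f g : Omega -> R) : measurable_fun setT f ->
  measurable_fun setT g -> cmeas (fun w => Complex (f w) (g w)).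
Proof. by []. Qed.

Lemma cmeas_real (f : Omega -> R) : measurable_fun setT f ->
  cmeas (fun w => (f w)%:C%C).
Proof. by move=> mf; apply: cmeas_Complex => //; exact: measurable_cst. Qed.

Lemma cmeasD f g : cmeas f -> cmeas g -> cmeas (fun w => f w + g w).
Proof.
move=> [f1 f2] [g1 g2]; split.
- rewrite (_ : (fun _ => _) = (fun w => complex.Re (f w)) \+ (fun w => complex.Re (g w))).
    exact: measurable_funD.
  by apply/funext => w /=; case: (f w) => ? ?; case: (g w).
- rewrite (_ : (fun _ => _) = (fun w => complex.Im (f w)) \+ (fun w => complex.Im (g w))).
    exact: measurable_funD.
  by apply/funext => w /=; case: (f w) => ? ?; case: (g w).
Qed.

Lemma cmeasM f g : cmeas f -> cmeas g -> cmeas (fun w => f w * g w).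
Proof.
move=> [f1 f2] [g1 g2]; split.
- rewrite (_ : (fun _ => _) =
    ((fun w => complex.Re (f w)) \* (fun w => complex.Re (g w))) \-
    ((fun w => complex.Im (f w)) \* (fun w => complex.Im (g w)))).
    by apply: measurable_funB; exact: measurable_funM.
  by apply/funext => w /=; case: (f w) => ? ?; case: (g w).
- rewrite (_ : (fun _ => _) =
    ((fun w => complex.Re (f w)) \* (fun w => complex.Im (g w))) \+
    ((fun w => complex.Im (f w)) \* (fun w => complex.Re (g w)))).
    by apply: measurable_funD; exact: measurable_funM.
  by apply/funext => w /=; case: (f w) => ? ?; case: (g w).
Qed.

Lemma cmeas_conjc f : cmeas f -> cmeas (fun w => conjc (f w)).
Proof.
move=> [f1 f2]; split.
- by rewrite (_ : (fun _ => _) = (fun w => complex.Re (f w))) //;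
    apply/funext => w /=; case: (f w).
- rewrite (_ : (fun _ => _) = \- (fun w => complex.Im (f w))).
    exact: measurable_funN.
  by apply/funext => w /=; case: (f w).
Qed.

Lemma cmeasN f : cmeas f -> cmeas (fun w => - f w).
Proof.
move=> mf; under eq_fun do rewrite -mulN1r.
by apply: cmeasM => //; exact: cmeas_cst.
Qed.

Lemma cmeas_sum I (s : seq I) (f : I -> Omega -> C) : (forall i, cmeas (f i)) ->
  cmeas (fun w => \sum_(i <- s) f i w).
Proof.
move=> mf; elim: s => [|i s IH].
  by under eq_fun do rewrite big_nil; exact: cmeas_cst.
by under eq_fun do rewrite big_cons; exact: cmeasD.
Qed.

Lemma cmeas_if (b : Omega -> bool) f g : measurable_fun setT b ->
  cmeas f -> cmeas g -> cmeas (fun w => if b w then f w else g w).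
Proof.
move=> mb [f1 f2] [g1 g2]; split.
- rewrite (_ : (fun _ => _) =
    (fun w => if b w then complex.Re (f w) else complex.Re (g w))).
    exact: measurable_fun_ifT.
  by apply/funext => w; case: (b w).
- rewrite (_ : (fun _ => _) =
    (fun w => if b w then complex.Im (f w) else complex.Im (g w))).
    exact: measurable_fun_ifT.
  by apply/funext => w; case: (b w).
Qed.

Lemma measurable_csq f : cmeas f -> measurable_fun setT (fun w => csq (f w)).
Proof. by move=> [f1 f2]; apply: measurable_funD; exact: measurable_funX. Qed.

Definition mxmeas m n (A : Omega -> 'M[C]_(m, n)) :=
  forall i j, cmeas (fun w => A w i j).

Lemma mxmeas_cst m n (A : 'M[C]_(m, n)) : mxmeas (fun=> A).
Proof. by move=> i j; exact: cmeas_cst. Qed.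

Lemma mxmeasD m n (A B : Omega -> 'M[C]_(m, n)) :
  mxmeas A -> mxmeas B -> mxmeas (fun w => A w + B w).
Proof. by move=> mA mB i j; under eq_fun do rewrite mxE; exact: cmeasD. Qed.

Lemma mxmeasN m n (A : Omega -> 'M[C]_(m, n)) :
  mxmeas A -> mxmeas (fun w => - A w).
Proof. by move=> mA i j; under eq_fun do rewrite mxE; exact: cmeasN. Qed.

Lemma mxmeasB m n (A B : Omega -> 'M[C]_(m, n)) :
  mxmeas A -> mxmeas B -> mxmeas (fun w => A w - B w).
Proof. by move=> mA mB; apply: mxmeasD => //; exact: mxmeasN. Qed.

Lemma mxmeasZ m n a (A : Omega -> 'M[C]_(m, n)) :
  cmeas a -> mxmeas A -> mxmeas (fun w => a w *: A w).
Proof. by move=> ma mA i j; under eq_fun do rewrite mxE; exact: cmeasM. Qed.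

Lemma mxmeas_mul m n p (A : Omega -> 'M[C]_(m, n)) (B : Omega -> 'M[C]_(n, p)) :
  mxmeas A -> mxmeas B -> mxmeas (fun w => A w *m B w).
Proof.
move=> mA mB i j; under eq_fun do rewrite mxE.
by apply: cmeas_sum => k; exact: cmeasM.
Qed.

Lemma mxmeas_herm m n (A : Omega -> 'M[C]_(m, n)) :
  mxmeas A -> mxmeas (fun w => herm (A w)).
Proof. by move=> mA i j; under eq_fun do rewrite !mxE; exact: cmeas_conjc. Qed.

Lemma mxmeas_vec m n (A : Omega -> 'M[C]_(m, n)) :
  mxmeas A -> mxmeas (fun w => vec (A w)).
Proof. by move=> mA i j; under eq_fun do rewrite !mxE. Qed.

Lemma mxmeas_col m n (A : Omega -> 'M[C]_(m, n)) j :
  mxmeas A -> mxmeas (fun w => col j (A w)).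
Proof. by move=> mA i k; under eq_fun do rewrite !mxE. Qed.

Lemma mxmeas_tens m n p q (A : Omega -> 'M[C]_(m, n)) (B : Omega -> 'M[C]_(p, q)) :
  mxmeas A -> mxmeas B -> mxmeas (fun w => A w *t B w).
Proof. by move=> mA mB i j; under eq_fun do rewrite mxE; exact: cmeasM. Qed.

Lemma mxmeas_sum m n I (s : seq I) (A : I -> Omega -> 'M[C]_(m, n)) :
  (forall i, mxmeas (A i)) -> mxmeas (fun w => \sum_(i <- s) A i w).
Proof.
move=> mA i j; under eq_fun do rewrite summxE.
by apply: cmeas_sum => k; exact: mA.
Qed.

Lemma mxmeas_if m n (b : Omega -> bool) (A B : Omega -> 'M[C]_(m, n)) :
  measurable_fun setT b -> mxmeas A -> mxmeas B ->
  mxmeas (fun w => if b w then A w else B w).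
Proof.
move=> mb mA mB i j; rewrite (_ : (fun _ => _) =
  (fun w => if b w then A w i j else B w i j)); first exact: cmeas_if.
by apply/funext => w; case: (b w).
Qed.

Lemma cmeas_cip m (u v : Omega -> 'cV[C]_m) : mxmeas u -> mxmeas v ->
  cmeas (fun w => cip (u w) (v w)).
Proof.
by move=> mu mv; apply: cmeas_sum => i; apply: cmeasM => //; exact: cmeas_conjc.
Qed.

Lemma measurable_vnorm2 m (v : Omega -> 'cV[C]_m) : mxmeas v ->
  measurable_fun setT (fun w => vnorm2 (v w)).
Proof. by move=> mv; apply: measurable_sum => i; exact: measurable_csq. Qed.

Lemma measurable_fnorm2 m n (A : Omega -> 'M[C]_(m, n)) : mxmeas A ->
  measurable_fun setT (fun w => fnorm2 (A w)).
Proof.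
move=> mA; apply: measurable_sum => i; apply: measurable_sum => j.
exact: measurable_csq.
Qed.

Lemma measurable_neq0 m (v : Omega -> 'cV[C]_m) : mxmeas v ->
  measurable_fun setT (fun w => v w != 0).
Proof.
move=> mv; under eq_fun do rewrite -vnorm2_eq0.
apply: measurable_neg; apply: measurable_fun_eqr; last exact: measurable_cst.
exact: measurable_vnorm2.
Qed.

(** For nonnegative [f] this is a real power with exponent minus one half, and powers are
    measurable. *)
Lemma measurable_invsqrt (f : Omega -> R) : (forall w, 0 <= f w) ->
  measurable_fun setT f -> measurable_fun setT (fun w => (Num.sqrt (f w))^-1).
Proof.
move=> f0 mf; under eq_fun => w do rewrite -(powR12_sqrt (f0 w)) -powRN.
exact: (measurableT_comp (measurable_powR _) mf).
Qed.

(** The length is deterministic, so that sums and folds over the random sequence have a fixed index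
    range. *)
Definition seqmeas m (F : Omega -> seq 'cV[C]_m) n :=
  (forall w, size (F w) = n) /\ (forall i, mxmeas (fun w => nth 0 (F w) i)).

Lemma seqmeas_cons m v (F : Omega -> seq 'cV[C]_m) n :
  mxmeas v -> seqmeas F n -> seqmeas (fun w => v w :: F w) n.+1.
Proof. by move=> mv [sF mF]; split=> [w /=|[|i]]; [rewrite sF|exact: mv|exact: mF]. Qed.

Lemma seqmeas_rcons m v (F : Omega -> seq 'cV[C]_m) n :
  mxmeas v -> seqmeas F n -> seqmeas (fun w => rcons (F w) (v w)) n.+1.
Proof.
move=> mv [sF mF]; split=> [w /=|i]; first by rewrite size_rcons sF.
under eq_fun do rewrite nth_rcons sF.
by case: ltngtP => _; [exact: mF|exact: mxmeas_cst|exact: mv].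
Qed.

Lemma seqmeas_take m (F : Omega -> seq 'cV[C]_m) n :
  seqmeas F n.+1 -> seqmeas (fun w => take n (F w)) n.
Proof.
move=> [sF mF]; split=> [w|i]; first by rewrite size_takel // sF.
have [il|li] := ltnP i n; first by under eq_fun do rewrite nth_take //; exact: mF.
under eq_fun do rewrite nth_default ?size_takel ?sF //; exact: mxmeas_cst.
Qed.

Lemma seqmeas_map m I (s : seq I) (f : I -> Omega -> 'cV[C]_m) :
  (forall i, mxmeas (f i)) -> seqmeas (fun w => [seq f i w | i <- s]) (size s).
Proof.
move=> mf; elim: s => [|i s IH]; last exact: seqmeas_cons.
by split=> // i; under eq_fun do rewrite nth_nil; exact: mxmeas_cst.
Qed.

Lemma mxmeas_gs_res m (F : Omega -> seq 'cV[C]_m) n v :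
  seqmeas F n -> mxmeas v -> mxmeas (fun w => gs_res (F w) (v w)).
Proof.
move=> [sF mF] mv; apply: mxmeasB => //.
under eq_fun do rewrite (big_nth 0) sF big_mkord.
by apply: mxmeas_sum => i; apply: mxmeasZ => //; exact: cmeas_cip.
Qed.

(** The selected index is random. Peeling off the head turns the search into a finite cascade of
    conditionals on measurable tests. *)
Lemma mxmeas_find m (F : Omega -> seq 'cV[C]_m) n : seqmeas F n ->
  mxmeas (fun w => nth 0 (F w) (find (fun v => v != 0) (F w))).
Proof.
elim: n F => [|n IH] F [sF mF].
  under eq_fun => w do rewrite (size0nil (sF w)); exact: mxmeas_cst.
rewrite (_ : (fun _ => _) = (fun w => if nth 0 (F w) 0 != 0 then nth 0 (F w) 0 else
    nth 0 (behead (F w)) (find (fun v => v != 0) (behead (F w))))); last first.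
  by apply/funext => w; case: (F w) (sF w) => //= v s _; case: ifP.
apply: mxmeas_if => //; first exact: measurable_neq0.
apply: IH; split=> [w|i]; first by rewrite size_behead sF.
by under eq_fun do rewrite nth_behead; exact: mF.
Qed.

Lemma mxmeas_gs_next m (F : Omega -> seq 'cV[C]_m) n c :
  seqmeas F n -> mxmeas c -> mxmeas (fun w => gs_next (F w) (c w)).
Proof.
move=> mF mc; set cands := fun w => gs_res (F w) (c w) ::
  [seq gs_res (F w) (delta_mx k 0) | k <- enum 'I_m].
have mw : mxmeas (fun w => nth 0 (cands w) (find (fun v => v != 0) (cands w))).
  apply: (@mxmeas_find _ cands (size (enum 'I_m)).+1).
  apply: seqmeas_cons; first exact: mxmeas_gs_res mF mc.
  by apply: seqmeas_map => k; exact: mxmeas_gs_res mF (mxmeas_cst _).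
apply: (mxmeasZ _ mw); apply: cmeas_real; apply: measurable_invsqrt.
  by move=> w; exact: vnorm2_ge0.
exact: measurable_vnorm2.
Qed.

Lemma seqmeas_gs_cols m (F : Omega -> seq 'cV[C]_m) n :
  seqmeas F n -> seqmeas (fun w => gs_cols (F w)) n.
Proof.
elim: n F => [|n IH] F mF.
  split=> [w|i]; first by rewrite size_gs_cols mF.1.
  under eq_fun do rewrite nth_default ?size_gs_cols ?mF.1 //.
  exact: mxmeas_cst.
(* [gs_cols] is a left fold, so the induction removes the last column. *)
have FE w : F w = rcons (take n (F w)) (nth 0 (F w) n).
  by rewrite -take_nth ?mF.1 // take_oversize // mF.1.
have mG := IH _ (seqmeas_take mF).
rewrite (_ : (fun _ => _) = (fun w => rcons (gs_cols (take n (F w)))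
  (gs_next (gs_cols (take n (F w))) (nth 0 (F w) n)))); last first.
  by apply/funext => w; rewrite [in LHS]FE gs_cols_rcons.
by apply: seqmeas_rcons => //; apply: mxmeas_gs_next mG _; exact: mF.2.
Qed.

Lemma mxmeas_qrQ m n (M : Omega -> 'M[C]_(m, n)) :
  mxmeas M -> mxmeas (fun w => qrQ (M w)).
Proof.
move=> mM i j; under eq_fun do rewrite mxE.
apply: (seqmeas_gs_cols _).2; apply: seqmeas_map => k; exact: mxmeas_col.
Qed.

Lemma mxmeas_qrR m n (M : Omega -> 'M[C]_(m, n)) :
  mxmeas M -> mxmeas (fun w => qrR (M w)).
Proof.
move=> mM i j; under eq_fun do rewrite mxE.
case: leqP => _; last exact: cmeas_cst.
by apply: cmeas_cip; apply: mxmeas_col => //; exact: mxmeas_qrQ.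
Qed.

Lemma measurable_le_set (f h : Omega -> R) :
  measurable_fun setT f -> measurable_fun setT h -> measurable [set w | f w <= h w].
Proof. by move=> mf mh; rewrite -[X in measurable X]setTI; exact: measurable_fun_le. Qed.

Lemma measurable_lt_set (f h : Omega -> R) :
  measurable_fun setT f -> measurable_fun setT h -> measurable [set w | f w < h w].
Proof.
move=> mf mh; rewrite [X in measurable X](_ : _ = ~` [set w | h w <= f w]).
  by apply: measurableC; exact: measurable_le_set.
by apply/seteqP; split=> w /=; rewrite ltNge => /negP.
Qed.

(** * Measurability of the decoder's events *)

Section Channel.
Variables (nr nt T : nat) (g : gidx nr nt T -> Omega -> R).
Variables (D : 'I_(kappa nt T) -> 'M[C]_(nt, T)) (theta : R) (eta : nat).
Hypothesis mg : forall i, measurable_fun setT (g i).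
Variable s : symvec (kappa nt T) eta.

Lemma mxmeas_chanH : mxmeas (chanH g).
Proof. by move=> i j; under eq_fun do rewrite mxE; exact: cmeas_Complex. Qed.

Lemma mxmeas_noiseW : mxmeas (noiseW g).
Proof. by move=> i j; under eq_fun do rewrite mxE; exact: cmeas_Complex. Qed.

Lemma mxmeas_received : mxmeas (fun w => received g D theta w s).
Proof.
apply: mxmeasD mxmeas_noiseW; apply: mxmeas_mul mxmeas_chanH _.
exact: mxmeas_cst.
Qed.

Lemma mxmeas_sdM : mxmeas (sdM g D theta).
Proof.
apply: mxmeasZ (cmeas_cst _) _; apply: mxmeas_mul (mxmeas_cst _).
exact: mxmeas_tens (mxmeas_cst _) mxmeas_chanH.
Qed.

Lemma mxmeas_sdr : mxmeas (fun w => sdr g D theta w s).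
Proof.
apply: mxmeas_mul; first by apply: mxmeas_herm; exact: mxmeas_qrQ mxmeas_sdM.
exact: mxmeas_vec mxmeas_received.
Qed.

(** There are finitely many competing symbol vectors, so the event is a finite union of comparisons
    of measurable functions. *)
Lemma measurable_ml_error : measurable [set w | ml_error g D theta w s].
Proof.
have mres (s' : symvec (kappa nt T) eta) : measurable_fun setT
    (fun w => fnorm2 (received g D theta w s - chanH g w *m codeword D theta s')).
  apply: measurable_fnorm2; apply: mxmeasB; first exact: mxmeas_received.
  by apply: mxmeas_mul; [exact: mxmeas_chanH|exact: mxmeas_cst].
rewrite [X in measurable X](_ : _ =
  \bigcup_(s' in [set s' : symvec (kappa nt T) eta | codeword D theta s' != codeword D theta s])
  [set w | fnorm2 (received g D theta w s - chanH g w *m codeword D theta s') <=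
    fnorm2 (received g D theta w s - chanH g w *m codeword D theta s)]).
  apply: fin_bigcup_measurable => [|s' _]; first exact: finite_finset.
  exact: measurable_le_set.
by apply/seteqP; split=> w /= [s']; [case; exists s'|exists s'].
Qed.

Lemma measurable_sd_dist (k : 'I_(kappa nt T).+1) (t : symvec k eta) :
  measurable_fun setT (fun w => sd_dist g D theta w s t).
Proof.
apply: measurable_sum => i; apply: measurable_csq; apply: cmeasD.
  exact: mxmeas_sdr.
apply: cmeasN; apply: cmeas_sum => j; apply: cmeasM (cmeas_cst _).
exact: mxmeas_qrR mxmeas_sdM _ _.
Qed.

Lemma measurable_sdNk xi2 (k : 'I_(kappa nt T).+1) :
  measurable_fun setT (fun w => (sdNk g D theta xi2 w s k)%:R : R).
Proof.
under eq_fun do rewrite sdNkE natr_sum.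
apply: measurable_sum => t.
rewrite (_ : (fun _ => _) = (fun w => if sd_dist g D theta w s t <= xi2 then 1 else 0)).
  apply: measurable_fun_ifT; try exact: measurable_cst.
  by apply: measurable_fun_ler; [exact: measurable_sd_dist|exact: measurable_cst].
by apply/funext => w; case: ifP.
Qed.

Lemma measurable_sd_empty xi2 (k : 'I_(kappa nt T).+1) :
  measurable [set w | sdNk g D theta xi2 w s k = 0%N].
Proof.
rewrite [X in measurable X](_ : _ = [set w | (sdNk g D theta xi2 w s k)%:R <= 0 :> R]).
  by apply: measurable_le_set; [exact: measurable_sdNk|exact: measurable_cst].
apply/seteqP; split=> w /= => [->//|].
by rewrite lern0 => /eqP.
Qed.

Lemma measurable_sdN xi2 (y : R) :
  measurable [set w | (sdN g D theta xi2 w s)%:R >= y].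
Proof.
apply: measurable_le_set; first exact: measurable_cst.
rewrite (_ : (fun _ => _) = (fun w => \sum_(k < (kappa nt T).+1)
    if (0 < k)%N then (sdNk g D theta xi2 w s k)%:R else 0)); last first.
  by apply/funext => w; rewrite /sdN natr_sum big_mkcond.
apply: measurable_sum => k; case: (0 < k)%N; last exact: measurable_cst.
exact: measurable_sdNk.
Qed.

End Channel.
End ComplexMeasurability.

(** * Gaussian tails *)

Section GaussianTail.
Variable R : realType.

Lemma normal_pdf0E (s x : R) : s != 0 ->
  normal_pdf 0 s x = normal_peak s * expR (- x ^+ 2 / (s ^+ 2 *+ 2)).
Proof. by move=> s0; rewrite /normal_pdf (negPf s0) /normal_fun subr0. Qed.

(* On [a <= x ^ 2] the density is at most [expR (- lam * a)] times a multiple of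
   a wider Gaussian density, which has total mass 1. *)
Lemma normal_prob_tail (lam : R) : 0 < lam < 1 ->
  exists2 K : R, 0 <= K & forall a : R,
    (normal_prob 0 (Num.sqrt 2^-1) [set x : R | (a <= x ^+ 2)%R] <= (K * expR (- (lam * a)))%:E)%E.
Proof.
move=> /andP[lam0 lam1].
set s := Num.sqrt _.
have s0 : s != 0 by rewrite gt_eqF // sqrtr_gt0 invr_gt0.
have s2 : s ^+ 2 *+ 2 = 1 by rewrite sqr_sqrtr ?invr_ge0 // -mulr_natr mulVf.
(* The density has exponent [- x ^+ 2]. Splitting off [lam * x ^+ 2], which is at least [lam * a] on
   the set, leaves [- (1 - lam) * x ^+ 2], the exponent for standard deviation [s']; the ratio [K]
   of the peaks matches the normalisations. *)
pose s' := Num.sqrt (2 * (1 - lam))^-1.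
have lam10 : 0 < 2 * (1 - lam) by rewrite mulr_gt0 // subr_gt0.
have s'0 : s' != 0 by rewrite gt_eqF // sqrtr_gt0 invr_gt0.
have s'2 : s' ^+ 2 *+ 2 = (1 - lam)^-1.
  rewrite sqr_sqrtr ?invr_ge0 ?ltW // -mulr_natr.
  by field; rewrite subr_eq0 gt_eqF //.
have p0 : 0 < normal_peak s' by exact: normal_peak_gt0.
pose K := normal_peak s / normal_peak s'.
have K0 : 0 <= K by rewrite mulr_ge0 ?normal_peak_ge0 // invr_ge0 ltW.
exists K => // a; set A := [set x | _].
have mA : measurable A.
  by rewrite -[A]setTI; apply: measurable_fun_le.
have c0 : 0 <= K * expR (- (lam * a)) by rewrite mulr_ge0 ?expR_ge0.
have mpdf' : measurable_fun setT (fun x : R => (normal_pdf 0 s' x)%:E).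
  by apply/measurable_EFinP; exact: measurable_normal_pdf.
rewrite /normal_prob.
apply: (@le_trans _ _ (\int[lebesgue_measure]_(x in A)
    ((K * expR (- (lam * a)))%:E * (normal_pdf 0 s' x)%:E))%E).
  apply: ge0_le_integral => //=.
  - by move=> x _; rewrite lee_fin normal_pdf_ge0.
  - by apply/measurable_EFinP; apply: measurable_funTS; exact: measurable_normal_pdf.
  - apply/measurable_EFinP; apply: measurable_funTS; apply: measurable_funM => //.
    exact: measurable_normal_pdf.
  move=> x; rewrite /A /= => ax; rewrite -EFinM lee_fin !normal_pdf0E //.
  have KE : K * normal_peak s' = normal_peak s by rewrite /K divfK // gt_eqF.
  rewrite s2 s'2 invrK divr1 mulrACA KE -expRD.
  by apply: ler_wpM2l; [exact: normal_peak_ge0|rewrite ler_expR; nra].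
rewrite ge0_integralZl_EFin //=; first last.
- exact: measurable_funTS.
- by move=> x _; rewrite lee_fin normal_pdf_ge0.
rewrite -[leRHS]mule1; apply: lee_wpmul2l; first by rewrite lee_fin.
rewrite -(integral_normal_pdf 0 s'); apply: ge0_subset_integral => //.
by move=> x _; rewrite lee_fin normal_pdf_ge0.
Qed.

(** Rounding down to multiples of [u], saturated at [K] so that only finitely many values occur; the
    saturated value carries no upper bound on [y]. *)
Lemma grid_approx (u y : R) (K : nat) : 0 <= y ->
  exists k : 'I_K.+1, (k%:R * u <= y) /\ (y <= k.+1%:R * u \/ k = K :> nat).
Proof.
move=> y0; elim: K => [|K [k [ky [yk|kK]]]].
- by exists ord0; split; [rewrite mul0r|right].
- by exists (widen_ord (leqnSn _) k); split=> //; left.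
have [yK|Ky] := leP y (K.+1%:R * u); last by exists ord_max; split; [exact: ltW|right].
by exists (inord K); rewrite inordK // -{1}kK; split=> //; left.
Qed.

End GaussianTail.

Section IidTail.
Variables (R : realType) (d : measure_display) (Omega : measurableType d).
Variable P : probability Omega R.

Lemma measure_bigsetU_le (I : Type) (s : seq I) (F : I -> set Omega) (c : R) :
  (forall i, measurable (F i)) -> (forall i, (P (F i) <= c%:E)%E) ->
  (P (\big[setU/set0]_(i <- s) F i) <= ((size s)%:R * c)%:E)%E.
Proof.
move=> mF Fc; elim: s => [|i s IH]; first by rewrite big_nil measure0 mul0r.
rewrite big_cons /= -natr1 mulrDl mul1r addrC EFinD.
apply: (le_trans (measureU2 _ (mF i) _)); first exact: bigsetU_measurable.
exact: leeD (Fc i) IH.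
Qed.

Lemma prode_le (I : finType) (x : I -> \bar R) (c : I -> R) :
  (forall i, (0 <= x i)%E) -> (forall i, (x i <= (c i)%:E)%E) ->
  (\prod_i x i <= (\prod_i c i)%:E)%E.
Proof.
move=> x0 xc.
suff : ((0 <= \prod_i x i)%E /\ (\prod_i x i <= (\prod_i c i)%:E)%E) by case.
elim/big_rec2: _ => [|i y1 y2 _ [h1 h2]]; first by split.
by split; [exact: mule_ge0|rewrite EFinM; exact: lee_pmul].
Qed.

(* If the squares sum to more than [t], rounding each of them down to a multiple
   of [t / K] loses less than [#|I|] steps in total, so one of finitely many
   product events, each of probability O(expR (- lam * t)), occurs. *)
Lemma iid_normal_tail (I : finType) (g : I -> Omega -> R) (lam : R) :
  iid_normal P g (Num.sqrt 2^-1) -> 0 < lam < 1 ->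
  exists C : R, forall t : R, 0 <= t ->
    (P [set w | (t < \sum_i g i w ^+ 2)%R] <= (C * expR (- (lam * t)))%:E)%E.
Proof.
move=> [mg gN gI] /andP[lam0 lam1].
(* The one-dimensional tail is taken at a rate above [lam]; the slack [lam' - lam] pays for the
   rounding. *)
pose lam' := (1 + lam) / 2.
have lam'0 : 0 < lam' < 1 by rewrite /lam'; lra.
have [K K0 tailK] := normal_prob_tail lam'0.
pose n := #|I|.
(* The grid is fine enough that losing [n] of its [N] steps costs at most the slack. *)
have [N Nn] : exists N : nat, (0 < N)%N /\ lam' * n%:R <= (lam' - lam) * N%:R.
  have ll : 0 < lam' - lam by rewrite /lam'; lra.
  exists (Num.trunc ((lam' - lam)^-1 * (lam' * n%:R))).+1; split=> //.
  by rewrite -ler_pdivrMl //; apply: ltW; exact: truncnS_gt.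
case: Nn => N0 Nn.
exists (#|{ffun I -> 'I_N.+1}|%:R * K ^+ n) => t t0.
pose u := t / N%:R.
have N0' : 0 < N%:R :> R by rewrite ltr0n.
have u0 : 0 <= u by rewrite divr_ge0 // ltW.
have tE : t = N%:R * u by rewrite /u mulrC divfK // gt_eqF.
clearbody u.
pose c := K ^+ n * expR (- (lam * t)).
have c0 : 0 <= c by rewrite mulr_ge0 ?exprn_ge0 ?expR_ge0.
pose box (k : {ffun I -> 'I_N.+1}) : set Omega :=
  \bigcap_(i in setT) (g i @^-1` [set x | (k i)%:R * u <= x ^+ 2]).
pose F (k : {ffun I -> 'I_N.+1}) := if (N <= \sum_i k i + n)%N then box k else set0.
have mB (a : R) : measurable [set x : R | a <= x ^+ 2].
  by rewrite -[X in measurable X]setTI; apply: measurable_fun_le => //; exact: measurable_cst.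
have mbox k : measurable (box k).
  apply: fin_bigcap_measurable => [|i _]; first exact: finite_finset.
  by rewrite -[X in measurable X]setTI; exact: mg.
have mF k : measurable (F k) by rewrite /F; case: ifP => _.
have Fc k : (P (F k) <= c%:E)%E.
  rewrite /F; case: ifP => [hk|_]; last by rewrite measure0 lee_fin.
  rewrite /box gI //.
  apply: (@le_trans _ _ (\prod_i (K * expR (- (lam' * ((k i)%:R * u)))))%:E).
    by apply: prode_le => i //; rewrite gN.
  rewrite lee_fin big_split /= prodr_const -/n /c ler_wpM2l ?exprn_ge0 //.
  rewrite -expR_sum ler_expR sumrN lerN2 -mulr_sumr -mulr_suml -natr_sum tE.
  have hk' : N%:R <= (\sum_i (k i : nat))%:R + n%:R :> R by rewrite -natrD ler_nat.
  move: lam'0 => /andP[l0 _].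
  rewrite !mulrA ler_wpM2r //.
  (* From [lam' * (N - n) >= lam * N], the rounded total times [lam'] is still at least
     [lam * N]. *)
  have := ler_wpM2l (ltW l0) hk'; move: Nn; rewrite mulrDr mulrBl. lra.
apply: le_trans (_ : (_ <= P (\big[setU/set0]_(k <- enum {ffun I -> 'I_N.+1}) F k))%E) _; last first.
  apply: le_trans (measure_bigsetU_le _ mF Fc) _.
  by rewrite -cardE mulrA.
apply: le_measure; rewrite ?inE.
- apply: measurable_lt_set => //; apply: measurable_sum => i.
  exact: measurable_funX.
- exact: bigsetU_measurable.
move=> w /= tw.
have gw i : 0 <= g i w ^+ 2 by rewrite sqr_ge0.
have /choice [k hk] := fun i => grid_approx u N (gw i).
rewrite -bigcup_seq; exists [ffun i => k i]; first by rewrite /= mem_enum.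
rewrite /F; case: ifP => [_ i _ /=|/negP]; first by rewrite ffunE; case: (hk i).
case; under eq_bigr do rewrite ffunE.
(* One saturated coordinate already contributes [N]. Otherwise each square is at most [k i + 1]
   steps, so the rounded total exceeds [N - n]. *)
have [/existsP[i /eqP ki]|/existsPn hN] := boolP [exists i, k i == N :> nat].
  by rewrite (bigD1 i) //= ki -addnA leq_addr.
have : (N%:R * u < (\sum_i (k i).+1)%:R * u)%R.
  rewrite -tE; apply: lt_le_trans tw _; rewrite natr_sum mulr_suml.
  apply: ler_sum => i _; case: (hk i) => _ [//|kN].
  by move: (hN i); rewrite kN eqxx.
move=> /lt_le_trans H; rewrite leqNgt; apply/negP => hlt.
have := H (N%:R * u); rewrite ltxx => h; suff : false by []. apply: h.
rewrite ler_wpM2r // ler_nat.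
under eq_bigr do rewrite -addn1.
by rewrite big_split /= sum1_card; exact: ltnW.
Qed.

End IidTail.

(** * Exponents of probabilities *)

Section UniformProb.
Variables (R : realType) (d : measure_display) (Omega : measurableType d).
Variables (P : probability Omega R) (k eta : nat).
Implicit Types E F : Omega -> symvec k eta -> Prop.

Definition mevent E := forall s, measurable [set w | E w s].

Lemma card_symvec_gt0 : 0 < #|{: symvec k eta}|%:R :> R.
Proof. by rewrite ltr0n card_ffun card_prod !card_ord addn1 expn_gt0. Qed.

Lemma Prob_ge0 E : 0 <= Prob P E.
Proof.
apply: mulr_ge0; first by rewrite invr_ge0.
by apply: sumr_ge0 => s _; exact: fine_ge0.
Qed.

Lemma Prob_le E F : mevent E -> mevent F -> (forall w s, E w s -> F w s) ->
  Prob P E <= Prob P F.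
Proof.
move=> mE mF EF; rewrite ler_pM2l ?invr_gt0 ?card_symvec_gt0 //.
apply: ler_sum => s _; apply: fine_le; rewrite ?fin_num_measure //.
by apply: le_measure; rewrite ?inE // => w; exact: EF.
Qed.

Lemma Prob_le_const E c : mevent E ->
  (forall s, (P [set w | E w s] <= c%:E)%E) -> Prob P E <= c.
Proof.
move=> mE Ec; rewrite /Prob ler_pdivrMl ?card_symvec_gt0 //.
rewrite mulr_natl -sumr_const; apply: ler_sum => s _.
by rewrite -lee_fin fineK ?fin_num_measure.
Qed.

Lemma Prob_le1 E : mevent E -> Prob P E <= 1.
Proof. by move=> mE; apply: Prob_le_const => // s; exact: probability_le1. Qed.

Lemma Prob_or E F : mevent E -> mevent F ->
  Prob P (fun w s => E w s \/ F w s) <= Prob P E + Prob P F.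
Proof.
move=> mE mF; rewrite -mulrDr ler_pM2l ?invr_gt0 ?card_symvec_gt0 //.
rewrite -big_split; apply: ler_sum => s _ /=.
have mEF := measurableU _ _ (mE s) (mF s).
rewrite -fineD ?fin_num_measure //; apply: fine_le.
- exact: fin_num_measure mEF.
- by rewrite fin_numD !fin_num_measure.
exact: measureU2 (mE s) (mF s).
Qed.

Lemma mevent_or E F : mevent E -> mevent F -> mevent (fun w s => E w s \/ F w s).
Proof. by move=> mE mF s; exact: measurableU (mE s) (mF s). Qed.

End UniformProb.

(** * Decay exponents and ratios of probabilities *)

Section Exponents.
Variable R : realType.
Implicit Types (p q rho e : R).

(** Since [expo] is [+oo] at [p = 0], the hypothesis also forces [p] to be positive. *)
Lemma expo_lt_powR p rho e : 1 < rho -> 0 <= p -> (expo p rho < e%:E)%E ->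
  rho `^ (- e) < p.
Proof.
move=> r1 p0; rewrite /expo; case: eqVneq => // pn0.
have lr : 0 < ln rho by rewrite ln_gt0.
have r0 : 0 < rho by exact: lt_trans r1.
have pp : 0 < p by rewrite lt_def pn0.
rewrite lte_fin ltr_pdivrMr // => h.
by rewrite -ltr_ln ?posrE ?powR_gt0 // ln_powR mulNr ltrNl.
Qed.

Lemma expo_gt_powR p rho e : 1 < rho -> 0 <= p -> (e%:E < expo p rho)%E ->
  p <= rho `^ (- e).
Proof.
move=> r1 p0; rewrite /expo; case: eqVneq => [-> _|pn0]; first exact: powR_ge0.
have lr : 0 < ln rho by rewrite ln_gt0.
have r0 : 0 < rho by exact: lt_trans r1.
have pp : 0 < p by rewrite lt_def pn0.
rewrite lte_fin ltr_pdivlMr // => h.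
rewrite -ler_ln ?posrE ?powR_gt0 // ln_powR mulNr lerNr.
exact: ltW.
Qed.

(** Used to choose a real rate below [Psi y], which may be [+oo]. *)
Lemma lt_ereal_dense (a : R) (b : \bar R) : (a%:E < b)%E ->
  exists2 e : R, a < e & (e%:E < b)%E.
Proof.
case: b => [v||] ab.
- by exists ((a + v) / 2); move: ab; rewrite !lte_fin => ab; lra.
- by exists (a + 1); rewrite ?ltrDl ?ltr01 // ltry.
- by rewrite ltNge leNye in ab.
Qed.

Lemma near_cvge_lt (f : R -> \bar R) l (a : \bar R) :
  f rho @[rho --> +oo] --> l -> (l < a)%E -> \forall rho \near +oo, (f rho < a)%E.
Proof.
move=> fl la; apply: (fl [set y | (y < a)%E]).
by apply: open_nbhs_nbhs; split=> //; exact: open_ereal_lt_ereal.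
Qed.

Lemma near_cvge_gt (f : R -> \bar R) l (a : \bar R) :
  f rho @[rho --> +oo] --> l -> (a < l)%E -> \forall rho \near +oo, (a < f rho)%E.
Proof.
move=> fl la; apply: (fl [set y | (a < y)%E]).
by apply: open_nbhs_nbhs; split=> //; exact: open_ereal_gt_ereal.
Qed.

Lemma near_pinfty_gt (a : R) : \forall rho \near +oo, a < rho.
Proof. exact: nbhs_pinfty_gt (num_real a). Qed.

Lemma powR_pinfty_cvg0 e : 0 < e -> rho `^ (- e) @[rho --> +oo] --> (0 : R).
Proof.
move=> e0; apply/cvgr0Pnorm_lt => eps eps0; near=> rho.
have r0 : 0 < rho by near: rho; exact: near_pinfty_gt.
rewrite ger0_norm ?powR_ge0 // -ltr_ln ?posrE ?powR_gt0 // ln_powR mulNr ltrNl.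
rewrite mulrC -ltr_pdivrMr // -ltr_expR lnK ?posrE.
  by near: rho; exact: near_pinfty_gt.
exact: r0.
Unshelve. all: by end_near. Qed.

(** For [m] midway between [e] and [e'], eventually [p rho] exceeds the power of [rho] with exponent
    [- m], so the ratio is at most [C] times a negative power of [rho]. *)
Lemma cvg_ratio0 (p q : R -> R) e e' C : expo (p rho) rho @[rho --> +oo] --> e%:E ->
  e < e' -> (forall rho, 0 <= p rho) ->
  (\forall rho \near +oo, 0 <= q rho <= C * rho `^ (- e')) ->
  q rho / p rho @[rho --> +oo] --> (0 : R).
Proof.
move=> pe ee' p0 qC; pose m := (e + e') / 2.
have em : e < m by rewrite /m; lra.
have me' : 0 < e' - m by rewrite /m; lra.
apply: (@squeeze_cvgr _ _ _ _ (fun=> 0) (fun rho => C * rho `^ (- (e' - m)))).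
- near=> rho.
  have r1 : 1 < rho by near: rho; exact: near_pinfty_gt.
  have pm : rho `^ (- m) < p rho.
    apply: expo_lt_powR => //; near: rho; exact: near_cvge_lt pe _.
  have /andP[q0 qle] : 0 <= q rho <= C * rho `^ (- e') by near: rho.
  rewrite divr_ge0 //=.
  have r0 : 0 < rho by rewrite (lt_trans _ r1).
  have rm : 0 < rho `^ (- m) by rewrite powR_gt0.
  rewrite opprB (_ : m - e' = - e' - - m); last by ring.
  rewrite powRB ?(gt_eqF r0) ?implybT // mulrA; apply: ler_pM => //.
    by rewrite invr_ge0.
  by rewrite lef_pV2 ?posrE //; [exact: ltW|exact: lt_trans pm].
- exact: cvg_cst.
rewrite -[X in _ --> X](mulr0 C); apply: cvgM; first exact: cvg_cst.
exact: powR_pinfty_cvg0.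
Unshelve. all: by end_near. Qed.

End Exponents.

(** The upper bound is [1 + 1 < expR 1]. Together the bounds make [ln 2] an admissible rate in
    [iid_normal_tail]. *)
Lemma ln2_bounds (R : realType) : 0 < ln (2 : R) < 1.
Proof.
rewrite ln_gt0 ?ltr1n //= -[ltRHS]expRK ltr_ln ?posrE ?expR_gt0 //.
by have := expR_gt1Dx (oner_neq0 R); rewrite -[1 + 1]/(2%:R).
Qed.

(** The right side adds the squares of the channel entries, so that the tail bound applies to the
    whole family [g]. *)
Lemma fnorm2_noiseW_le (R : realType) (Omega : Type) (nr nt T : nat)
    (g : gidx nr nt T -> Omega -> R) (w : Omega) : fnorm2 (noiseW g w) <= \sum_i g i w ^+ 2.
Proof.
have -> : \sum_i g i w ^+ 2 = \sum_a (g (a, true) w ^+ 2 + g (a, false) w ^+ 2).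
  transitivity (\sum_a \sum_b g (a, b) w ^+ 2).
    by rewrite pair_bigA; apply: eq_bigr => -[].
  by apply: eq_bigr => a _; rewrite big_bool.
rewrite big_sumType /= /fnorm2 pair_bigA /=.
rewrite [X in X <= _](_ : _ = \sum_a (g (inr a, true) w ^+ 2 + g (inr a, false) w ^+ 2)).
  by rewrite lerDr; apply: sumr_ge0 => a _; rewrite addr_ge0 ?sqr_ge0.
by apply: eq_bigr => -[i j] _; rewrite mxE.
Qed.

Theorem theorem1 (R : realType) (dsp : measure_display) (Omega : measurableType dsp)
  (P : probability Omega R) (nt nr T : nat)
  (g : gidx nr nt T -> Omega -> R)
  (D : 'I_(kappa nt T) -> 'M[R[i]]_(nt, T))
  (r : R) (eta : R -> nat) (theta : R -> R) (dr z : R) (Psi : R -> \bar R) :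
  (0 < nt)%N -> (0 < T)%N -> (nt <= nr)%N ->
  (* entries of H and W i.i.d. CN(0,1): real/imag parts i.i.d. N(0,1/2) *)
  iid_normal P g (Num.sqrt (2^-1)) ->
  (* full rank generator matrix *)
  genmx_of D \in unitmx ->
  (* multiplexing gain and the rho-dependent code parameters *)
  0 <= r <= nt%:R ->
  doteq (fun rho => (eta rho)%:R) (r * T%:R / (2 * (kappa nt T)%:R)) ->
  doteq (fun rho => theta rho ^+ 2) (1 - r * T%:R / (kappa nt T)%:R) ->
  (* the ML diversity gain d(r) = dr exists *)
  (expo (Prob P (ml_error g D (theta rho) (eta := eta rho))) rho
     @[rho --> +oo] --> dr%:E) ->
  (* sphere radius xi^2 = z log_2 rho with z > d(r) *)
  dr < z ->
  (* Psi(x) exists for every x *)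
  (forall x : R,
     expo (Prob P (fun w (s : symvec (kappa nt T) (eta rho)) =>
             ((sdN g D (theta rho) (z * ln rho / ln 2) w s)%:R >= rho `^ x)))
          rho @[rho --> +oo] --> Psi x) ->
  forall x : R, (sd_exponent Psi dr < x%:E)%E ->
  (Prob P (fun w (s : symvec (kappa nt T) (eta rho)) =>
       ml_error g D (theta rho) w s
       \/ sdNk g D (theta rho) (z * ln rho / ln 2) w s ord_max = 0%N
       \/ (sdN g D (theta rho) (z * ln rho / ln 2) w s)%:R >= rho `^ x)
     / Prob P (ml_error g D (theta rho) (eta := eta rho)))
    @[rho --> +oo] --> (1 : R).
Proof.
move=> _ _ _ iid _ _ _ _ pML drz NPsi x xc.
have mg : forall i, measurable_fun setT (g i) by case: iid.
have mML rho : mevent (@ml_error R Omega nr nt T g D (theta rho) (eta rho)).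
  by move=> s; exact: measurable_ml_error.
pose xi2 (rho : R) := z * ln rho / ln 2.
pose empty rho (w : Omega) (s : symvec (kappa nt T) (eta rho)) :=
  sdNk g D (theta rho) (xi2 rho) w s ord_max = 0%N.
have mempty rho : mevent (empty rho).
  by move=> s; exact: measurable_sd_empty.
pose busy y rho (w : Omega) (s : symvec (kappa nt T) (eta rho)) : Prop :=
  (sdN g D (theta rho) (xi2 rho) w s)%:R >= rho `^ y.
have mbusy y rho : mevent (busy y rho).
  by move=> s; exact: measurable_sdN.
pose p rho := Prob P (@ml_error R Omega nr nt T g D (theta rho) (eta rho)).
pose q1 rho := Prob P (empty rho).
pose q2 rho := Prob P (busy x rho).
have p0 rho : 0 <= p rho by exact: Prob_ge0.
(* Probabilities are at most 1. This makes [z] positive and the squared radius nonnegative, as the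
   tail bound requires. *)
have dr0 : 0 <= dr.
  rewrite -lee_fin; apply: cvge_to_ge pML _; near=> rho.
  have r1 : 1 < rho by near: rho; exact: near_pinfty_gt.
  rewrite /expo; case: eqVneq => [_|pn0]; first exact: leey.
  rewrite lee_fin divr_ge0 ?(ltW (ln_gt0 r1)) // oppr_ge0 ln_le0 //.
  exact: Prob_le1.
have [C tailC] := iid_normal_tail iid (ln2_bounds R).
have /andP[ln20 _] := ln2_bounds R.
have q1p : q1 rho / p rho @[rho --> +oo] --> (0 : R).
  apply: (@cvg_ratio0 _ p q1 dr z C) => //; near=> rho.
  have r1 : 1 < rho by near: rho; exact: near_pinfty_gt.
  have xi20 : 0 <= xi2 rho.
    by rewrite divr_ge0 ?(ltW ln20) // mulr_ge0 ?(ltW (ln_gt0 r1)) // (le_trans dr0) // ltW.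
  rewrite Prob_ge0 /=; apply: Prob_le_const => // s.
  (* At rate [ln 2] the base-2 logarithm in the radius turns the exponential into exactly this
     power. *)
  have -> : rho `^ (- z) = expR (- (ln 2 * xi2 rho)).
    rewrite /powR gt_eqF ?(lt_trans ltr01) // mulNr; congr (expR (- _)).
    by rewrite /xi2 [RHS]mulrC divfK // gt_eqF.
  apply: le_trans (tailC _ xi20); apply: le_measure; rewrite ?inE.
  - exact: mempty.
  - apply: measurable_lt_set => //; apply: measurable_sum => i.
    exact: measurable_funX.
  by move=> w h; exact: lt_le_trans (sd_empty_noise h) (fnorm2_noiseW_le g w).
have q2p : q2 rho / p rho @[rho --> +oo] --> (0 : R).
  (* The infimum lies below [x], so some [y < x] has [Psi y > dr]; [e'] is a real rate strictly
     between [dr] and [Psi y]. *)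
  have [_ [y dy <-]] := ereal_inf_lt xc; rewrite lte_fin => yx.
  have [e' de' e'Psi] := lt_ereal_dense dy.
  apply: (@cvg_ratio0 _ p q2 dr e' 1) => //; near=> rho.
  have r1 : 1 < rho by near: rho; exact: near_pinfty_gt.
  (* For [rho > 1] a node count reaching the threshold at [x] also reaches the one at [y]. *)
  rewrite Prob_ge0 mul1r /=; apply: (@le_trans _ _ (Prob P (busy y rho))).
    apply: Prob_le => // w s; apply: le_trans.
    by rewrite ler_powR // ltW.
  apply: expo_gt_powR => //; first exact: Prob_ge0.
  by near: rho; exact: near_cvge_gt (NPsi y) _.
apply: (@squeeze_cvgr _ _ _ _ (fun=> 1) (fun rho => 1 + (q1 rho / p rho + q2 rho / p rho))).
- near=> rho.
  have r1 : 1 < rho by near: rho; exact: near_pinfty_gt.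
  (* An exponent eventually below [dr + 1] is finite, which excludes a zero denominator. *)
  have pp : 0 < p rho.
    apply: le_lt_trans (powR_ge0 rho (- (dr + 1))) _; apply: expo_lt_powR => //.
    by near: rho; apply: near_cvge_lt pML _; rewrite lte_fin ltrDl ltr01.
  have mq := mevent_or (mempty rho) (mbusy x rho).
  apply/andP; split.
    rewrite ler_pdivlMr // mul1r; apply: Prob_le => //; first exact: mevent_or.
    by move=> w s h; left.
  rewrite ler_pdivrMr // !mulrDl mul1r !divfK ?gt_eqF //.
  apply: (le_trans (Prob_or P (mML rho) mq)); rewrite lerD2l.
  exact: Prob_or.
- exact: cvg_cst.
rewrite -[X in _ --> X]addr0; apply: cvgD; first exact: cvg_cst.
by rewrite -[X in _ --> X]addr0; exact: cvgD.
Unshelve. all: by end_near. Qed.
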